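(* Let $m$ be a positive even integer and $n$ a positive odd integer. The number of group homomorphisms from $D_m$ into $D_n$ is $$1+2n+n\left(\sum_{k\mid \gcd(m,n)}\phi(k)\right),$$ where the sum runs over the positive divisors $k$ of $\gcd(m,n)$.
   Context: For a positive integer $l$, $D_l$ denotes the finite (dihedral) group, of order $2l$, generated by two generators $r_l$ and $f_l$ subject to the relations $r_l^l = e = f_l^2$ and $r_l f_l = f_l r_l^{-1}$. $\phi$ denotes Euler's totient function. Homomorphisms are not required to be injective. *)

(* Defs.v *)
From mathcomp Require Import all_boot all_fingroup zmodp all_solvable.

Set Implicit Arguments.
Unset Strict Implicit.
Unset Printing Implicit Defensive.

Local Open Scope group_scope.

(* gT, as a whole, is the dihedral group D_l of order 2l.  The notation 'D_(2l)
   of extremal.v is not used because it is only meaningful for l >= 2: at l = 1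
   it denotes a group of order 4. *)
Definition is_dihedral (l : nat) (gT : finGroupType) : Prop :=
  #|[set: gT]| = (2 * l)%N /\
  [set: gT] \isog Grp (r : f : r ^+ l, f ^+ 2, r * f = f * r^-1).

Definition homs (gT hT : finGroupType) : {set {ffun gT -> hT}} :=
  [set u : {ffun gT -> hT} | morphic [set: gT] u].

Lemma homsP (gT hT : finGroupType) (u : {ffun gT -> hT}) :
  reflect {morph u : x y / x * y} (u \in homs gT hT).
Proof.
rewrite inE; apply: (iffP morphicP) => [uM x y | uM x y _ _]; last exact: uM.
by apply: uM; rewrite inE.
Qed.

Lemma is_dihedral_D (l : nat) : 1 < l -> is_dihedral l ('D_(l.*2))%type.
Proof.
move=> l_gt1; split; first by rewrite mul2n card_dihedral.
move=> rT H; rewrite (Grp_dihedral l_gt1).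
apply: eq_existsb => -[x y] /=; rewrite !xpair_eqE /=; do 3!congr (_ && _).
by rewrite conjgC (can_eq (mulKg y)).
Qed.

Lemma is_dihedral_exists (l : nat) :
  0 < l -> exists gT : finGroupType, is_dihedral l gT.
Proof.
case: l => [|[|l]] // _; last first.
  by exists ('D_(l.+2.*2))%type; apply: is_dihedral_D.
exists 'Z_2; split; first by rewrite cardsT card_ord.
pose z : 'Z_2 := Zp1.
have defZ : [set: 'Z_2] = <[z]> := Zp_cycle 1.
have oz : #[z] = 2 := order_Zp1 1.
apply: intro_isoGrp => [|rT H].
  apply/existsP; exists (1, z); rewrite /= !xpair_eqE /=.
  by rewrite cycle1 joing1G defZ invg1 mul1g mulg1 !eqxx.
case/existsP=> -[x y] /= /eqP[defH x1 y2 _].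
have dvd_yz : #[y] %| #[z] by rewrite order_dvdn oz y2.
rewrite defZ; apply/homgP; exists (eltm_morphism dvd_yz).
by rewrite morphim_cycle ?cycle_id //= eltm_id -defH (x1 : x = 1) cycle1 joing1G.
Qed.

(* Main.v *)
(* Homomorphisms out of D_m correspond to pairs (x, y) satisfying its defining
   relations, here in D_n.  As n is odd, D_n is a cyclic group R of n rotations
   together with n involutions, each inverting R, and R has no involution.  As m
   is even, y = 1 leaves x = 1 or x an involution (1 + n pairs); an involution y
   leaves x in R with x^m = 1 (n * gcd(m, n) pairs) or x = y (n pairs). *)
Require Import Defs.
From mathcomp Require Import all_boot all_fingroup.
From mathcomp Require Import cyclic.

Set Implicit Arguments.
Unset Strict Implicit.
Unset Printing Implicit Defensive.

Definition dihedral_pairs (l : nat) (gT : finGroupType) : {set gT * gT} :=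
  [set p | [&& p.1 ^+ l == 1, p.2 ^+ 2 == 1 & p.1 * p.2 == p.2 * p.1^-1]]%g.

Lemma dihedral_pairsP l (gT : finGroupType) (x y : gT) :
  reflect [/\ x ^+ l = 1, y ^+ 2 = 1 & x * y = y * x^-1]%g
          ((x, y) \in dihedral_pairs l gT).
Proof.
by rewrite inE; apply: (iffP and3P) => -[/eqP xl /eqP y2 /eqP xy].
Qed.

(** Specialising the presentation to the group itself yields the generators. The last relation says
    that [f] conjugates [r] to its inverse, so [f] normalises [<[r]>] and the join is a product. *)
Lemma dihedral_generators l (gT : finGroupType) : is_dihedral l gT ->
  exists r f : gT, (r, f) \in dihedral_pairs l gT /\
    (<[r]> * <[f]>)%g = [set: gT].
Proof.
case=> _ isoG; have := isoG gT setT; rewrite homg_refl => /esym/existsP[[r f]].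
move=> /= /eqP[defG rl f2 rf]; exists r, f; split; first exact/dihedral_pairsP.
rewrite -defG norm_joinEr // cycle_subG; apply/normP.
by rewrite -cycleJ conjgE rf mulKg cycleV.
Qed.

Lemma homsX (gT hT : finGroupType) (u : {ffun gT -> hT}) x i :
  u \in homs gT hT -> u (x ^+ i)%g = (u x ^+ i)%g.
Proof.
move/homsP=> uM; have u1: u 1%g = 1%g.
  by apply: (mulgI (u 1%g)); rewrite -uM !mulg1.
by elim: i => [|i IHi]; rewrite ?expg0 // !expgS uM IHi.
Qed.

(* Given a pair satisfying the relations in hT, the subgroup H of gT * hT
   generated by (r, x) and (f, y) satisfies them too, so it is no larger than
   gT; as it projects onto gT, it is the graph of a homomorphism. *)
Lemma hom_extension l (gT hT : finGroupType) (r f : gT) (x y : hT) :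
    is_dihedral l gT -> (r, f) \in dihedral_pairs l gT ->
    (<[r]> * <[f]>)%g = [set: gT] -> (x, y) \in dihedral_pairs l hT ->
  exists u, [/\ u \in homs gT hT, u r = x & u f = y].
Proof.
move=> dihG /dihedral_pairsP[rl f2 rf] defG /dihedral_pairsP[xl y2 xy].
pose H := (<[(r, x)]> <*> <[(f, y)]>)%G.
have Hrx : (r, x) \in H by rewrite mem_gen // inE cycle_id.
have Hfy : (f, y) \in H by rewrite mem_gen // inE cycle_id orbT.
have XE (a : gT) (b : hT) i : ((a, b) ^+ i = (a ^+ i, b ^+ i))%g.
  by elim: i => // i IHi; rewrite !expgS IHi.
have leH : #|H| <= #|[set: gT]|.
  apply: dvdn_leq; first exact: cardG_gt0.
  apply: card_homg; rewrite dihG.2; apply/existsP; exists ((r, x), (f, y)).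
  rewrite /= !XE rl f2 xl y2 !xpair_eqE !eqxx /=.
  by apply/andP; split; apply/eqP.
have imH : [set p.1 | p in H] = [set: gT].
  apply/eqP; rewrite -subTset -defG; apply/subsetP.
  move=> _ /mulsgP[_ _ /cycleP[i ->] /cycleP[j ->] ->].
  apply/imsetP; exists ((r, x) ^+ i * (f, y) ^+ j)%g.
    by rewrite groupM ?groupX.
  by rewrite !XE.
have injH : {in H &, injective (fun p : gT * hT => p.1)}.
  by apply/imset_injP; rewrite imH eqn_leq leH -{1}imH leq_imset_card.
(* The default [1] is never taken: [imH] supplies some [b] for every [a]. *)
pose u := [ffun a => odflt 1%g [pick b | (a, b) \in H]].
have Hu a : (a, u a) \in H.
  rewrite ffunE; case: pickP => //= noH.
  have: a \in [set p.1 | p in H] by rewrite imH inE.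
  by case/imsetP=> -[a' b] Hab /= eq_a; rewrite -eq_a noH in Hab.
have uE a b : (a, b) \in H -> u a = b.
  by move=> Hab; have [] := injH _ _ (Hu a) Hab erefl.
exists u; split; [|exact: uE..].
by apply/homsP=> a b; apply: uE; exact: (groupM (Hu a) (Hu b)).
Qed.

(** Evaluation at the generators is a bijection: injective because every element is some
    [r ^+ i * f ^+ j], onto by [hom_extension]. *)
Lemma card_homs_dihedral l (gT hT : finGroupType) :
  is_dihedral l gT -> #|homs gT hT| = #|dihedral_pairs l hT|.
Proof.
move=> dihG; have [r [f [rfP defG]]] := dihedral_generators dihG.
pose ev (u : {ffun gT -> hT}) := (u r, u f).
rewrite -(card_in_imset (f := ev)) => [|u v uH vH [uvr uvf]].
  congr #|pred_of_set _|; apply/setP=> -[x y]; apply/imsetP/idP=> [[u uH []]|xyP].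
    case/dihedral_pairsP: rfP => rl f2 rf.
    move/homsP: (uH) => uM -> ->; have u1 : u 1%g = 1%g.
      by rewrite -(expg0 r) homsX.
    have uV : (u r)^-1%g = u r^-1%g.
      by apply/eqP; rewrite eq_invg_mul -uM mulgV u1.
    by apply/dihedral_pairsP; rewrite uV -!homsX // -!uM rl f2 rf.
  have [u [uH ur uf]] := hom_extension dihG rfP defG xyP.
  by exists u => //; rewrite /ev ur uf.
apply/ffunP=> a; have: a \in [set: gT] by rewrite inE.
rewrite -defG => /mulsgP[_ _ /cycleP[i ->] /cycleP[j ->] ->].
move/homsP: (uH) => uM; move/homsP: (vH) => vM.
by rewrite uM vM !homsX // uvr uvf.
Qed.

(** The solutions form the unique subgroup of order [gcdn m #|G|], generated by a power [b] of a
    generator [a]. *)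
Lemma card_cyclic_expg1 (gT : finGroupType) (G : {group gT}) m :
  cyclic G -> #|[set x in G | x ^+ m == 1]%g| = gcdn m #|G|.
Proof.
case/cyclicP=> a defG; have a_gt0 := order_gt0 a.
pose g := gcdn m #[a]%g; have g_dvd : g %| #[a]%g by exact: dvdn_gcdr.
have g_gt0 : 0 < g := dvdn_gt0 a_gt0 g_dvd.
pose b := (a ^+ (#[a]%g %/ g))%g.
have ob : #[b]%g = g by rewrite orderXdiv ?dvdn_div // divnA // mulKn.
rewrite {2}defG -orderE -/g -ob; apply: eq_card => x; rewrite inE -order_dvdn.
apply/andP/idP=> [[Gx xm]|bx].
  (* Inside a cyclic group, inclusion of subgroups amounts to divisibility of their orders. *)
  rewrite -cycle_subG -(@cardSg_cyclic _ <[a]>) ?cycle_cyclic //.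
  - change (#[x]%g %| #[b]%g).
    by rewrite ob dvdn_gcd xm; have := order_dvdG Gx; rewrite defG.
  - by rewrite cycle_subG; move: Gx; rewrite defG.
  by rewrite cycle_subG mem_cycle.
split; last by rewrite (dvdn_trans (order_dvdG bx)) // -orderE ob dvdn_gcdl.
by rewrite defG; apply: (subsetP _ x bx); rewrite cycle_subG mem_cycle.
Qed.

(** Gauss's identity, carried over from a sum over ordinals to the list of divisors. *)
Lemma sum_totient_divisors n :
  0 < n -> \sum_(k <- divisors n) totient k = n.
Proof.
move=> n_gt0; rewrite -[RHS]sum_totient_dvd.
rewrite -(big_mkord (fun d => d %| n) totient) -[RHS]big_filter.
apply: perm_big; apply: uniq_perm => [||k].
- exact: divisors_uniq.
- by rewrite filter_uniq ?iota_uniq.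
rewrite -dvdn_divisors // mem_filter mem_index_iota ltnS.
by case: (boolP (k %| n)) => // /dvdn_leq->.
Qed.

Lemma odd_dihedral_structure n (gT : finGroupType) :
    odd n -> is_dihedral n gT ->
  exists R : {group gT}, [/\ cyclic R, #|R| = n,
    forall y, y \notin R -> (y ^+ 2 = 1)%g,
    forall x y, x \in R -> y \notin R -> (x * y = y * x^-1)%g &
    forall x y, x \notin R -> y \notin R -> (x * y)%g \in R].
Proof.
move=> n_odd dihG; have [r [f [/dihedral_pairsP[rn f2 rf] defG]]] :=
  dihedral_generators dihG.
have [oG _] := dihG; have n_gt0 := odd_gt0 n_odd.
have r_le : #[r]%g <= n by rewrite dvdn_leq // order_dvdn rn.
have f_le : #[f]%g <= 2 by rewrite dvdn_leq // order_dvdn f2.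
(* The relations only bound the orders of [r] and [f] by [n] and 2; a group of [2 * n] elements
   forces the first bound to be attained. *)
have or : #[r]%g = n.
  have : 2 * n <= #[r]%g * 2.
    rewrite -oG -defG (leq_trans (dvdn_leq _ (dvdn_cardMg _ _))) //.
      by rewrite muln_gt0 !cardG_gt0.
    by rewrite leq_mul2l f_le orbT.
  by rewrite mulnC leq_pmul2r // => n_le; apply/eqP; rewrite eqn_leq r_le.
have rXf i : (r ^+ i * f = f * (r ^+ i)^-1)%g.
  elim: i => [|i IHi]; first by rewrite expg0 invg1 mul1g mulg1.
  by rewrite {1}expgSr -mulgA rf mulgA IHi -mulgA -invMg expgS.
have outE y : y \notin <[r]>%g -> exists i, y = (r ^+ i * f)%g.
  have: y \in [set: gT] by rewrite inE.
  rewrite -defG => /mulsgP[_ _ /cycleP[i ->] /cycleP[j ->] ->] nR.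
  (* Only the parity of [j] matters, and an even [j] would put the element in [<[r]>]. *)
  exists i; rewrite -(odd_double_half j) in nR *.
  move: nR; rewrite -muln2 expgD mulnC expgM f2 expg1n mulg1.
  by case: (odd j) => //; rewrite expg0 mulg1 mem_cycle.
exists <[r]>%G; split.
- exact: cycle_cyclic.
- exact: or.
- move=> _ /outE[i ->].
  by rewrite expgS expg1 {2}rXf mulgA -(mulgA (r ^+ i)%g) -(expgS f 1) f2
             mulg1 mulgV.
- move=> _ _ /cycleP[i ->] /outE[j ->].
  rewrite mulgA -expgD addnC expgD -mulgA (rXf i) mulgA.
  reflexivity.
move=> _ _ /outE[i ->] /outE[j ->].
by rewrite (rXf j) mulgA -(mulgA (r ^+ i)%g) -(expgS f 1) f2 mulg1
           groupM ?groupV ?mem_cycle.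
Qed.

Lemma card_dihedral_pairs m n (gT : finGroupType) :
    ~~ odd m -> odd n -> is_dihedral n gT ->
  #|dihedral_pairs m gT| = 1 + 2 * n + n * gcdn m n.
Proof.
move=> m_even n_odd dihG.
have [R [cycR oR outX2 outJ outM]] := odd_dihedral_structure n_odd dihG.
have oGR : #|~: R| = n.
  by rewrite cardsCs setCK -cardsT dihG.1 oR mul2n -addnn addnK.
have R2 x : x \in R -> (x ^+ 2 = 1)%g -> x = 1%g.
  move=> Rx x2; apply/eqP; rewrite -order_eq1 -dvdn1.
  (* The order of [x] divides both 2 and the odd number [n]. *)
  have /eqP <- : coprime 2 n by rewrite coprime2n.
  by rewrite dvdn_gcd order_dvdn x2 eqxx -oR order_dvdG.
have evenX (x : gT) : (x ^+ 2 = 1)%g -> (x ^+ m = 1)%g.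
  by rewrite -(even_halfK m_even) -mul2n expgM => ->; rewrite expg1n.
pose A := [set x in R | x ^+ m == 1]%g.
have oA : #|A| = gcdn m n by rewrite card_cyclic_expg1 ?oR.
(* [P1] collects the pairs with [y] trivial, [P2] those with [x] a rotation and [y] a reflection,
   [P3] those with [x] and [y] the same reflection. *)
pose P1 : {set gT * gT} := setX (1%g |: ~: R) [set 1%g].
pose P2 : {set gT * gT} := setX A (~: R).
pose P3 : {set gT * gT} := [set (x, x) | x in ~: R].
have -> : dihedral_pairs m gT = P1 :|: (P2 :|: P3).
  apply/setP=> -[x y]; apply/dihedral_pairsP/idP=> [[xm y2 xy]|]; last first.
    case/setUP=> [/setXP[/= x1 /set1P->]|/setUP[]].
    - case/setU1P: x1 => [->|]; first by rewrite !expg1n invg1.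
      rewrite inE => /outX2 x2; rewrite evenX // expg1n mulg1 mul1g; split=> //.
      by apply/esym/eqP; rewrite eq_invg_mul -x2.
    - by case/setXP=> /[!inE] /andP[Rx /eqP xm] nRy; rewrite outX2 // outJ.
    case/imsetP=> z /[!inE] nRz [-> ->]; have z2 := outX2 _ nRz.
    by rewrite evenX // mulgV; split.
  (* A rotation [y] of square 1 is trivial, and the relation then reads [x = x^-1]. *)
  rewrite !inE /=; case: (boolP (y \in R)) => [Ry | nRy].
    have y1 := R2 y Ry y2; rewrite y1 mulg1 mul1g in xy *; rewrite eqxx.
    case: (boolP (x \in R)) => Rx; last by rewrite orbT.
    by rewrite (R2 x Rx) ?eqxx // expgS expg1 {2}xy mulgV.
  case: (boolP (x \in R)) => [Rx | nRx]; first by rewrite xm eqxx !orbT.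
  have xVx : (x^-1 = x)%g by apply/eqP; rewrite eq_invg_mul -(expgS x 1) outX2.
  (* For two reflections the relation reads [x * y = y * x], so the rotation [x * y] squares to 1
     and is trivial. *)
  have xy1 : (x * y = 1)%g.
    apply: R2; first exact: outM.
    rewrite expgS expg1 {2}xy xVx mulgA -(mulgA x) -(expgS y 1) y2 mulg1.
    by rewrite -(expgS x 1) outX2.
  have -> : y = x by rewrite -xVx; apply/esym/eqP; rewrite eq_invg_mul xy1.
  by rewrite imset_f ?orbT // inE.
(* Membership of the second component in [R] separates [P1] from the others; that of the first
   separates [P2] from [P3]. *)
have dis1 : P1 :&: (P2 :|: P3) = set0.
  apply/setP=> -[x y]; rewrite !inE /=; apply/negP=> /andP[/andP[_ /eqP->]].
  rewrite group1 andbF => /imsetP[z /[!inE] nRz [_ z1]].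
  by rewrite -z1 group1 in nRz.
have dis2 : P2 :&: P3 = set0.
  apply/setP=> -[x y]; rewrite !inE /=; apply/negP=> /andP[/andP[/andP[Rx _] _]].
  by case/imsetP=> z /[!inE] nRz [xz _]; rewrite -xz Rx in nRz.
rewrite cardsU dis1 cards0 subn0 cardsU dis2 cards0 subn0 !cardsX cards1 cardsU1.
rewrite card_imset => [|x y []//]; rewrite !inE group1 oA oGR /=.
by rewrite muln1 mulnC mul2n -addnn -!addnA; congr (_ + (_ + _)); rewrite addnC.
Qed.

Theorem theorem4 (m n : nat) (Dm Dn : finGroupType)
    (m_gt0 : 0 < m) (m_even : ~~ odd m) (n_gt0 : 0 < n) (n_odd : odd n)
    (dihDm : is_dihedral m Dm) (dihDn : is_dihedral n Dn) :
  #|homs Dm Dn| =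
    1 + 2 * n + n * (\sum_(k <- divisors (gcdn m n)) totient k).
Proof.
rewrite sum_totient_divisors ?gcdn_gt0 ?m_gt0 //.
by rewrite (card_homs_dihedral _ dihDm) (card_dihedral_pairs m_even n_odd dihDn).
Qed.
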